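(* Let $E$ be an Archimedean vector lattice with the principal projection property, let $F$ be a Dedekind complete vector lattice, let $\Phi:\mathfrak{B}(E)\to\mathfrak{B}(F)$ be a Boolean homomorphism, and let $T:E\to F$ be a positive orthogonally additive operator. Let $T=T_1+T_2$ be the unique decomposition with $T_1\in\Phi(E,F)$ and $T_2\in\Phi(E,F)^{\perp}$ (disjoint complement in $\mathcal{OA}_r(E,F)$). Then $$T_1=\inf\Big\{\sum_{i=1}^{n}\Phi(\pi_i)\,T\,\pi_i:\ (\pi_i)_{i=1}^n\in\mathfrak{D}_0\Big\},$$ where the infimum is taken in the vector lattice $\mathcal{OA}_r(E,F)$.
   Context: All vector lattices are real and Archimedean. Two elements $x,y$ of a vector lattice are disjoint ($x\perp y$) if $|x|\wedge|y|=0$. An order projection on a vector lattice $E$ is a positive linear projection $\pi:E\to E$ with $0\le\pi\le Id$. The set $\mathfrak{B}(E)$ of all order projections on $E$ is a Boolean algebra with the operations $\pi\wedge\rho=\pi\circ\rho$, $\pi\vee\rho=\pi+\rho-\pi\circ\rho$, $\overline{\pi}=Id-\pi$. $E$ has the principal projection property if for every $x\in E$ the band generated by $x$ is a projection band. A Boolean homomorphism is a map between Boolean algebras preserving $\vee$, $\wedge$ and complements. $\mathfrak{D}_0$ is the set of all finite partitions of the identity of $E$, i.e. finite families $(\pi_i)_{i=1}^n$ in $\mathfrak{B}(E)$, $n\in\mathbb{N}$, with $\pi_k\wedge\pi_j=0$ for $k\ne j$ and $\sum_{i=1}^n\pi_i=Id$. Operators here are possibly nonlinear maps. A map $T:E\to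 F$ is an atomic operator subordinate to $\Phi$ if $T\circ\pi=\Phi(\pi)\circ T$ for every $\pi\in\mathfrak{B}(E)$; the set of all such maps is denoted $\Phi(E,F)$. A map $T:E\to F$ is orthogonally additive if $T(x+y)=Tx+Ty$ whenever $x\perp y$, and positive if $Tx\ge 0$ for all $x\in E$. $\mathcal{OA}_r(E,F)$ is the vector space of all differences of two positive orthogonally additive maps from $E$ to $F$, ordered by $S\le T$ iff $T-S$ is positive. When $F$ is Dedekind complete, $\mathcal{OA}_r(E,F)$ is a Dedekind complete vector lattice, and (for $E$ with the principal projection property) $\Phi(E,F)$ is a band in it, hence a projection band, so that the decomposition $T=T_1+T_2$ exists and is unique. *)

(* Defs.v *)
From HB Require Import structures.
From mathcomp Require Import all_boot all_order all_algebra.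
From mathcomp Require Import boolp classical_sets functions reals.

Set Implicit Arguments.
Unset Strict Implicit.
Unset Printing Implicit Defensive.

Import Order.TTheory GRing.Theory.
Local Open Scope ring_scope.
Local Open Scope classical_set_scope.

(** * Vector lattices *)

(* [vjoin x y] and [vmeet x y] are the supremum and the infimum of [{x, y}] for
   the partial order of [E]. *)
HB.mixin Record isVectorLattice (R : realType) E
    of GRing.Lmodule R E & Num.POrderedZmodule E := {
  vjoin : E -> E -> E;
  vmeet : E -> E -> E;
  vjoin_le : forall x y z : E, (vjoin x y <= z) = (x <= z) && (y <= z);
  le_vmeet : forall x y z : E, (z <= vmeet x y) = (z <= x) && (z <= y);
  vlat_leD : forall x y z : E, x <= y -> x + z <= y + z;
  vlat_scale_ge0 : forall (a : R) (x : E), 0 <= a -> 0 <= x -> 0 <= a *: x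
}.

#[short(type="vectorLatticeType")]
HB.structure Definition VectorLattice (R : realType) :=
  { E of isVectorLattice R E & GRing.Lmodule R E & Num.POrderedZmodule E }.

Section VectorLatticeNotions.
Context {R : realType} {E : vectorLatticeType R}.
Implicit Types (x y z b c : E) (A B D : set E).

Definition vabs x : E := vjoin x (- x).

Definition vdisjoint x y : Prop := vmeet (vabs x) (vabs y) = 0.

Definition vdisjoint_compl A : set E := [set x | forall y, A y -> vdisjoint x y].

Definition is_subspace A : Prop :=
  A 0 /\ forall (a : R) x y, A x -> A y -> A (a *: x + y).

Definition is_solid A : Prop :=
  forall x y, A y -> vabs x <= vabs y -> A x.

Definition is_band B : Prop :=
  [/\ is_subspace B, is_solid B &
      forall D s, D `<=` B -> isLub D s -> B s].

Definition band_generated x : set E :=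
  [set y | forall B, is_band B -> B x -> B y].

Definition is_projection_band B : Prop :=
  is_band B /\
  forall x, exists b c, [/\ B b, vdisjoint_compl B c & x = b + c].

End VectorLatticeNotions.

Definition archimedean_vlat (R : realType) (E : vectorLatticeType R) : Prop :=
  forall x y : E, 0 <= x -> (forall n : nat, x *+ n <= y) -> x = 0.

Definition principal_projection_property
    (R : realType) (E : vectorLatticeType R) : Prop :=
  forall x : E, is_projection_band (band_generated x).

Definition dedekind_complete (R : realType) (F : vectorLatticeType R) : Prop :=
  forall A : set F, A !=set0 -> ubound A !=set0 -> exists s, isLub A s.

(** * The Boolean algebra of order projections *)

Record orderProj (R : realType) (E : vectorLatticeType R) := OrderProj {
  oproj_fun :> E -> E;
  oproj_linear : linear oproj_fun;
  oproj_idem : forall x, oproj_fun (oproj_fun x) = oproj_fun x;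
  oproj_ge0 : forall x, 0 <= x -> 0 <= oproj_fun x;
  oproj_le_id : forall x, 0 <= x -> oproj_fun x <= x
}.

HB.instance Definition _ (R : realType) (E : vectorLatticeType R)
    (p : orderProj E) :=
  GRing.isLinear.Build R E E _ (oproj_fun p) (oproj_linear p).

Section OrderProjections.
Context {R : realType} {E : vectorLatticeType R}.
Implicit Types (x y z : E) (p q : orderProj E).

Lemma vlat_subr_ge0 x y : (0 <= y - x) = (x <= y).
Proof.
apply/idP/idP => [/(vlat_leD _ _ x)|/(vlat_leD _ _ (- x))]; first by rewrite add0r subrK.
by rewrite subrr.
Qed.

Lemma vlat_diff_ge0 x : exists y z, [/\ 0 <= y, 0 <= z & x = y - z].
Proof.
have := lexx (vjoin x 0); rewrite vjoin_le => /andP[xj j0].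
exists (vjoin x 0), (vjoin x 0 - x); split; first exact: j0.
- by rewrite vlat_subr_ge0.
- by rewrite subKr.
Qed.

Lemma oprojB p x y : p (x - y) = p x - p y.
Proof. exact: linearB. Qed.

Lemma oproj_mono p x y : x <= y -> p x <= p y.
Proof.
rewrite -(vlat_subr_ge0 x) -(vlat_subr_ge0 (p x)) -oprojB; exact: oproj_ge0.
Qed.

Lemma orderProj_eq p q : (forall x, p x = q x) -> p = q.
Proof.
case: p q => [f f1 f2 f3 f4] [g g1 g2 g3 g4] /= /funext fg.
by move: f1 f2 f3 f4; rewrite fg => *; congr OrderProj; exact: Prop_irrelevance.
Qed.

Lemma oprojC p q x : p (q x) = q (p x).
Proof.
have key p' q' z : p' (q' (p' z)) = q' (p' z).
  have [y [w [y0 w0 ->]]] := vlat_diff_ge0 z.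
  suff pos t : 0 <= t -> p' (q' (p' t)) = q' (p' t) by rewrite !oprojB (pos y)// (pos w).
  move=> t0; apply/le_anti; rewrite oproj_le_id ?oproj_ge0//=.
  have h : q' (p' t) <= p' t by rewrite oproj_le_id// oproj_ge0.
  have : p' t - q' (p' t) - p' (p' t - q' (p' t)) >= 0.
    by rewrite vlat_subr_ge0 oproj_le_id// vlat_subr_ge0.
  by rewrite oprojB oproj_idem opprB addrC subrKA vlat_subr_ge0.
have key2 p' q' z : p' (q' z) = p' (q' (p' z)).
  have [y [w [y0 w0 ->]]] := vlat_diff_ge0 z.
  suff pos t : 0 <= t -> p' (q' t) = p' (q' (p' t)) by rewrite !oprojB (pos y)// (pos w).
  move=> t0.
  have u0 : 0 <= t - p' t by rewrite vlat_subr_ge0 oproj_le_id.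
  apply/eqP; rewrite -subr_eq0 -!oprojB; apply/eqP/le_anti.
  rewrite !oproj_ge0// andbT.
  have := oproj_mono p' (oproj_le_id q' u0).
  by rewrite [p' (t - p' t)]oprojB oproj_idem subrr.
by rewrite key2 key.
Qed.

Definition oprojI p q : orderProj E.
Proof.
exists (fun x => p (q x)).
- by move=> a x y; rewrite !linearP.
- by move=> x; rewrite (oprojC q p) !oproj_idem.
- by move=> x x0; rewrite !oproj_ge0.
- move=> x x0; apply: le_trans (oproj_le_id q x0).
  exact/oproj_le_id/oproj_ge0.
Defined.

Definition oprojN p : orderProj E.
Proof.
exists (fun x => x - p x).
- by move=> a x y; rewrite linearP scalerBr opprD addrACA.
- by move=> x; rewrite oprojB oproj_idem subrr subr0.
- by move=> x x0; rewrite vlat_subr_ge0 oproj_le_id.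
- by move=> x x0; rewrite -vlat_subr_ge0 subKr oproj_ge0.
Defined.

Lemma oprojU_deMorgan p q x :
  oprojN (oprojI (oprojN p) (oprojN q)) x = p x + q x - p (q x).
Proof.
by rewrite /= oprojB !opprB addrCA [x + _]addrC subrK addrAC.
Qed.

Definition oprojU p q : orderProj E.
Proof.
exists (fun x => p x + q x - p (q x)).
- by move=> a x y; rewrite -!oprojU_deMorgan linearP.
- by move=> x; rewrite -!oprojU_deMorgan oproj_idem.
- by move=> x x0; rewrite -oprojU_deMorgan oproj_ge0.
- by move=> x x0; rewrite -oprojU_deMorgan oproj_le_id.
Defined.

Definition oproj0 : orderProj E.
Proof.
exists (fun=> 0) => // a x y.
by rewrite scaler0 addr0.
Defined.

End OrderProjections.

Arguments oproj0 {R E}.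

Definition boolean_hom (R : realType) (E F : vectorLatticeType R)
    (Phi : orderProj E -> orderProj F) : Prop :=
  [/\ forall p q, Phi (oprojU p q) = oprojU (Phi p) (Phi q),
      forall p q, Phi (oprojI p q) = oprojI (Phi p) (Phi q) &
      forall p, Phi (oprojN p) = oprojN (Phi p)].

Definition partition_of_id (R : realType) (E : vectorLatticeType R) (n : nat)
    (p : 'I_n -> orderProj E) : Prop :=
  (forall k j, k != j -> oprojI (p k) (p j) = oproj0) /\
  (forall x, \sum_(i < n) p i x = x).

(** * Orthogonally additive operators *)

Section Operators.
Context {R : realType} {E F : vectorLatticeType R}.
Implicit Types (S T : E -> F) (V A : set (E -> F)).

Definition orthogonally_additive T : Prop :=
  forall x y, vdisjoint x y -> T (x + y) = T x + T y.

(* Positivity of a nonlinear operator is required on all of [E], not only on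
   the positive cone. *)
Definition positive_op T : Prop := forall x, 0 <= T x.

Definition op_le S T : Prop := positive_op (T - S).

Definition OAr : set (E -> F) :=
  [set T | exists T' T'', [/\ orthogonally_additive T', positive_op T',
                             orthogonally_additive T'', positive_op T'' &
                             T = T' - T'']].

(* Suprema and infima are relative to the ordered space [OAr], i.e. only
   upper and lower bounds belonging to [OAr] compete. *)
Definition is_sup_OAr A T : Prop :=
  [/\ OAr T, forall S, A S -> op_le S T &
      forall U, OAr U -> (forall S, A S -> op_le S U) -> op_le T U].

Definition is_inf_OAr A T : Prop :=
  [/\ OAr T, forall S, A S -> op_le T S &
      forall U, OAr U -> (forall S, A S -> op_le U S) -> op_le U T].

(* |S| /\ |T| = 0 in [OAr], where |S| = S \/ (- S); the lattice operations are
   characterised by the order. *)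
Definition disjoint_OAr S T : Prop :=
  exists absS absT, [/\ is_sup_OAr [set S; - S] absS,
                        is_sup_OAr [set T; - T] absT &
                        is_inf_OAr [set absS; absT] 0].

Definition disjoint_compl_OAr A : set (E -> F) :=
  [set T | OAr T /\ forall S, A S -> disjoint_OAr T S].

Definition atomic_ops (Phi : orderProj E -> orderProj F) : set (E -> F) :=
  [set T : E -> F | forall p : orderProj E, T \o p = Phi p \o T].

Definition partition_sums (Phi : orderProj E -> orderProj F) T :
    set (E -> F) :=
  [set S | exists n (p : 'I_n.+1 -> orderProj E),
     partition_of_id p /\
     S = (fun x => \sum_(i < n.+1) Phi (p i) (T (p i x)))].

End Operators.

(* Main.v *)
Require Import Defs.
From mathcomp Require Import all_boot all_order all_algebra.
From mathcomp Require Import boolp classical_sets functions reals.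

Set Implicit Arguments.
Unset Strict Implicit.
Unset Printing Implicit Defensive.

Import Order.TTheory GRing.Theory Num.Theory.
Local Open Scope ring_scope.

(** For a positive orthogonally additive [S] and a partition [p] write
    [S_p = \sum_i Phi (p i) S (p i)]; then [S_p <= S], and [S_p = S] when [S] is
    atomic.  Let [G x] be the infimum in [F] of the [T_p x].  Splitting each
    [p i] along a projection [q] shows that [G] is atomic, so [G] belongs to
    [OAr] and is the infimum of the [T_p] there.  It remains to see that
    [K = G - T1], an atomic operator, vanishes.  Put [H = T - G >= 0] and let [B]
    be the modulus of [T2 = H + K].  Then [|K| <= B + H] pointwise, and summing
    over a partition gives [|K| <= B_p + H_p <= B + T_p - G]; the infimum over
    [p] yields [|K| <= B].  Since [T2] is disjoint from [K], this forces
    [|K| = 0]. *)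

(** * Vector lattices *)

Section VectorLatticeTheory.
Context {R : realType} {E : vectorLatticeType R}.
Implicit Types (u v w x y z : E) (p q : orderProj E).

Lemma vleD x y z t : x <= y -> z <= t -> x + z <= y + t :> E.
Proof.
move=> xy zt; apply: le_trans (vlat_leD _ _ z xy) _.
by rewrite ![y + _]addrC; apply: vlat_leD.
Qed.

Lemma vle_subl_addr x y z : (x - y <= z) = (x <= z + y).
Proof. by rewrite -(vlat_subr_ge0 (x - y)) -(vlat_subr_ge0 x) opprB addrA. Qed.

Lemma vaddr_ge0 x y : 0 <= x -> 0 <= y -> 0 <= x + y.
Proof. by move=> x0 y0; rewrite -(addr0 0) vleD. Qed.

Lemma vler_addl x y : 0 <= y -> x <= x + y.
Proof. by move=> y0; rewrite -{1}(addr0 x) vleD. Qed.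

Lemma vler_subl x y : 0 <= y -> x - y <= x.
Proof. by move=> y0; rewrite vle_subl_addr vler_addl. Qed.

Lemma voppr_le x y : (- x <= y) = (0 <= y + x).
Proof. by rewrite -sub0r vle_subl_addr. Qed.

Lemma vler_sum (I : finType) (f g : I -> E) :
  (forall i, f i <= g i) -> \sum_i f i <= \sum_i g i.
Proof.
move=> fg; apply: (big_ind2 (fun a b : E => a <= b)) => // *; exact: vleD.
Qed.

Lemma vsum_ge0 (I : finType) (f : I -> E) :
  (forall i, 0 <= f i) -> 0 <= \sum_i f i.
Proof. by move=> f0; apply: (big_ind (fun a : E => 0 <= a)) => // *; exact: vaddr_ge0. Qed.

Lemma vjoin_ub x y : x <= vjoin x y /\ y <= vjoin x y.
Proof. by apply/andP; rewrite -vjoin_le. Qed.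

Lemma vmeet_lb x y : vmeet x y <= x /\ vmeet x y <= y.
Proof. by apply/andP; rewrite -le_vmeet. Qed.

Lemma le_vabs x : x <= vabs x. Proof. by case: (vjoin_ub x (- x)). Qed.

Lemma leN_vabs x : - x <= vabs x. Proof. by case: (vjoin_ub x (- x)). Qed.

Lemma vabs_le x y : x <= y -> - x <= y -> vabs x <= y.
Proof. by move=> h1 h2; rewrite vjoin_le h1. Qed.

(** Adding the bounds of [vabs x] by [x] and [- x] shows that its double is nonnegative, and a real
    scalar halves it. *)
Lemma vabs_ge0 x : 0 <= vabs x.
Proof.
have h2 : 0 <= vabs x + vabs x by rewrite -(subrr x) vleD ?le_vabs ?leN_vabs.
have -> : vabs x = 2^-1 *: (vabs x + vabs x).
  by rewrite -mulr2n -scaler_nat scalerA mulVf ?scale1r ?pnatr_eq0.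
by apply: vlat_scale_ge0 => //; rewrite invr_ge0.
Qed.

Lemma ger0_vabs x : 0 <= x -> vabs x = x.
Proof.
move=> x0; apply/le_anti; rewrite le_vabs andbT; apply: vabs_le => //.
by rewrite voppr_le vaddr_ge0.
Qed.

Lemma vabs_eq0 x : vabs x = 0 -> x = 0.
Proof.
move=> x0; apply/le_anti; rewrite -{1}x0 le_vabs /=.
by have := leN_vabs x; rewrite x0 voppr_le add0r.
Qed.

Lemma vabsD x y : vabs (x + y) <= vabs x + vabs y.
Proof. by apply: vabs_le; rewrite ?opprD vleD ?le_vabs ?leN_vabs. Qed.

Lemma vscale_le (a : R) x y : 0 <= a -> x <= y -> a *: x <= a *: y.
Proof.
by move=> a0; rewrite -vlat_subr_ge0 -(vlat_subr_ge0 (a *: x)) -scalerBr; apply: vlat_scale_ge0.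
Qed.

Lemma vabsZ_le (a : R) x : vabs (a *: x) <= `|a| *: vabs x.
Proof.
have [a0|a0] := ger0P a; [|move/ltW in a0]; apply: vabs_le.
- by rewrite vscale_le ?le_vabs.
- by rewrite -scalerN vscale_le ?leN_vabs.
- by rewrite -[a *: x]opprK -scaleNr -scalerN vscale_le ?oppr_ge0 ?leN_vabs.
- by rewrite -scaleNr vscale_le ?oppr_ge0 ?le_vabs.
Qed.

(** * Disjointness *)

Lemma vmeet_eq0 u v : 0 <= u -> 0 <= v ->
  (forall w, 0 <= w -> w <= u -> w <= v -> w <= 0) -> vmeet u v = 0.
Proof.
move=> u0 v0 h; have [h1 h2] := vmeet_lb u v.
have m0 : 0 <= vmeet u v by rewrite le_vmeet u0.
by apply/le_anti; rewrite m0 andbT; apply: h.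
Qed.

Lemma vmeet0_le0 u v w : vmeet u v = 0 -> w <= u -> w <= v -> w <= 0.
Proof. by move=> <- wu wv; rewrite le_vmeet wu. Qed.

Lemma vmeet0_le u u' v : 0 <= u -> 0 <= v -> u <= u' -> vmeet u' v = 0 ->
  vmeet u v = 0.
Proof.
move=> u0 v0 uu' h; apply: vmeet_eq0 => // w w0 wu wv.
by apply: (vmeet0_le0 h) => //; exact: le_trans uu'.
Qed.

Lemma vmeetC0 u v : 0 <= u -> 0 <= v -> vmeet u v = 0 -> vmeet v u = 0.
Proof. by move=> u0 v0 h; apply: vmeet_eq0 => // w _ wv wu; exact: (vmeet0_le0 h). Qed.

(** If [m] lies below [u + v] and [w], then [m - v] lies below [u] and [w], so [m <= v]; lying also
    below [w], [m] is at most 0. *)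
Lemma vmeet0D u v w : 0 <= u -> 0 <= v -> 0 <= w ->
  vmeet u w = 0 -> vmeet v w = 0 -> vmeet (u + v) w = 0.
Proof.
move=> u0 v0 w0 uw vw; apply: vmeet_eq0 => // [|m m0 muv mw].
  exact: vaddr_ge0.
apply: (vmeet0_le0 vw) => //; rewrite -[v]add0r -vle_subl_addr.
apply: (vmeet0_le0 uw); first by rewrite vle_subl_addr.
by apply: le_trans mw; exact: vler_subl.
Qed.

(** Natural multiples follow from additivity by induction, and [a *: u] is dominated by such a
    multiple. *)
Lemma vmeet0Z (a : R) u w : 0 <= a -> 0 <= u -> 0 <= w ->
  vmeet u w = 0 -> vmeet (a *: u) w = 0.
Proof.
move=> a0 u0 w0 uw.
have nat_case n : 0 <= u *+ n /\ vmeet (u *+ n) w = 0.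
  elim: n => [|n [un0 IHn]]; first by rewrite mulr0n; split=> //; apply: vmeet_eq0.
  by rewrite mulrS; split; [exact: vaddr_ge0 | exact: vmeet0D].
have [n /ltW an] : exists n : nat, a < n%:R.
  by exists (Num.bound a); exact: archi_boundP.
apply: (@vmeet0_le _ (u *+ n)) (nat_case n).2 => //.
  exact: vlat_scale_ge0.
rewrite -vlat_subr_ge0 -scaler_nat -scalerBl.
by apply: vlat_scale_ge0; rewrite ?subr_ge0.
Qed.

(** The element [u + v - z] lies below both [u] and [v]. *)
Lemma vmeet0_addr_le u v z : vmeet u v = 0 -> u <= z -> v <= z -> u + v <= z.
Proof.
move=> uv uz vz; rewrite -[z]add0r -vle_subl_addr.
by apply: (vmeet0_le0 uv); rewrite vle_subl_addr; [|rewrite addrC]; apply: vleD.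
Qed.

Lemma vdisjointC x y : vdisjoint x y -> vdisjoint y x.
Proof. exact: vmeetC0 (vabs_ge0 x) (vabs_ge0 y). Qed.

Lemma vdisjoint_subspace y : is_subspace [set x | vdisjoint x y].
Proof.
have y0 := vabs_ge0 y; split=> [|a x z /= xy zy].
  by apply: vmeet_eq0; rewrite ?vabs_ge0 // => w _; rewrite ger0_vabs.
apply: (@vmeet0_le _ (`|a| *: vabs x + vabs z)); rewrite ?vabs_ge0 //.
  by apply: le_trans (vabsD _ _) _; apply: vleD => //; exact: vabsZ_le.
apply: vmeet0D => //; rewrite ?vabs_ge0 ?vlat_scale_ge0 ?normr_ge0 ?vabs_ge0 //.
by apply: vmeet0Z; rewrite ?normr_ge0 ?vabs_ge0.
Qed.

(* If [s = sup D] with [D] disjoint from [y], then [m = s^+ /\ |y|] is disjoint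
   from every [d^+], so [s^+ - m] is still an upper bound of [D]; the negative
   part of [s] is dominated by that of any [d] in [D]. *)
Lemma vdisjoint_lub y (D : set E) s :
  (D `<=` [set x | vdisjoint x y])%classic -> isLub D s -> vdisjoint s y.
Proof.
move=> Dy [sub lub].
have y0 := vabs_ge0 y.
(* A supremum of the empty set is a least element of [E], which can only be 0. *)
have [D0|/set0P[d Dd]] := eqVneq D set0.
  have s_min z : s <= z by apply: lub; rewrite D0.
  have -> : s = 0.
    by apply/le_anti; rewrite s_min /= -(addrK s 0) vle_subl_addr add0r s_min.
  exact: (vdisjoint_subspace y).1.
set sp := vjoin s 0; have [ssp sp0] := vjoin_ub s 0.
have disjp x : D x -> vmeet (vjoin x 0) (vabs y) = 0.
  move=> /Dy xy; apply: vmeet0_le xy; rewrite ?(vjoin_ub x 0).2 //.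
  by rewrite vjoin_le le_vabs vabs_ge0.
set m := vmeet sp (vabs y).
have [msp my] := vmeet_lb sp (vabs y).
have m0 : 0 <= m by rewrite le_vmeet sp0.
have sp_m : vjoin s 0 <= sp - m.
  rewrite vjoin_le; apply/andP; split; last by rewrite vlat_subr_ge0.
  apply: lub => x Dx; rewrite -[x](addrK m) vleD //.
  have [xp xp0] := vjoin_ub x 0.
  apply: le_trans (vleD xp (lexx m)) _; apply: vmeet0_addr_le => //.
    apply: vmeet_eq0 => // w w0 wx wm.
    by apply: (vmeet0_le0 (disjp _ Dx)) => //; exact: le_trans my.
  by rewrite vjoin_le sp0 andbT; apply: le_trans ssp; exact: sub.
have spy : vmeet sp (vabs y) = 0.
  apply/le_anti; rewrite m0 andbT -vlat_subr_ge0 sub0r.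
  by rewrite -(addKr sp (- m)) addrC vlat_subr_ge0.
apply: (@vmeet0_le _ (sp + vabs d)); rewrite ?vabs_ge0 //; last first.
  by apply: vmeet0D; rewrite ?vabs_ge0 //; exact: Dy.
apply: vabs_le; first by rewrite (le_trans ssp) // vler_addl ?vabs_ge0.
apply: (@le_trans _ _ (vabs d)); last by rewrite addrC vler_addl.
apply: le_trans (leN_vabs d); rewrite -vlat_subr_ge0 opprK addrC vlat_subr_ge0.
exact: sub.
Qed.


Lemma vdisjoint_band y : is_band [set x | vdisjoint x y].
Proof.
split; [exact: vdisjoint_subspace | | exact: vdisjoint_lub].
by move=> x z /= zy xz; apply: vmeet0_le xz zy; exact: vabs_ge0.
Qed.

(** * Order projections *)

Lemma oprojD p x y : p (x + y) = p x + p y.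
Proof. exact: linearD. Qed.

Lemma oproj0r p : p 0 = 0.
Proof. exact: linear0. Qed.

(** The nontrivial inequality comes from applying [p] to [|x| <= |p x| + |x - p x|]: the last term
    is at most [oprojN p |x|], which [p] kills. *)
Lemma oproj_vabs p x : p (vabs x) = vabs (p x).
Proof.
have abs_le q z : vabs (q z) <= q (vabs z).
  apply: vabs_le; first exact: oproj_mono (le_vabs z).
  by rewrite -sub0r -(oproj0r q) -oprojB sub0r; apply: oproj_mono (leN_vabs z).
apply/le_anti; rewrite abs_le andbT.
have split_le : vabs x <= vabs (p x) + vabs (oprojN p x).
  by rewrite -{1}[x](subrK (p x)) addrC vabsD.
apply: le_trans (oproj_mono p split_le) _; rewrite oprojD -[vabs (p x)]addr0.
apply: vleD; first by rewrite addr0 oproj_le_id ?vabs_ge0.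
apply: le_trans (oproj_mono p (abs_le (oprojN p) x)) _.
by rewrite /= oprojB oproj_idem subrr.
Qed.

(** A common minorant [w] of the moduli satisfies [p w <= |p y| = 0] and
    [w - p w <= |x| - |p x| = 0]. *)
Lemma oproj_vdisjoint p x y : p x = x -> p y = 0 -> vdisjoint x y.
Proof.
move=> px py; apply: vmeet_eq0; rewrite ?vabs_ge0 // => w w0 wx wy.
have pw : p w <= 0.
  by rewrite -(ger0_vabs (lexx 0)) -py -oproj_vabs; exact: oproj_mono.
have : w - p w <= vabs x - p (vabs x) by exact: (oproj_mono (oprojN p) wx).
rewrite oproj_vabs px subrr vle_subl_addr add0r => /le_trans; exact.
Qed.

(** The projection picks the component in [B]. Two such components differ by an element disjoint
    from itself, so the component is unique, and linearity follows from uniqueness. *)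
Lemma projection_band_oproj (B : set E) : is_projection_band B ->
  exists p : orderProj E,
    (forall x, B x -> p x = x) /\ (forall x, vdisjoint_compl B x -> p x = 0).
Proof.
move=> [[[B0 BP] Bsolid _] dec].
have BN x : B x -> B (- x) by move=> Bx; rewrite -[- x]addr0 -scaleN1r; apply: BP.
have compl0 : vdisjoint_compl B 0 by move=> y _; exact: (vdisjoint_subspace y).1.
have complP a x y : vdisjoint_compl B x -> vdisjoint_compl B y ->
    vdisjoint_compl B (a *: x + y).
  by move=> cx cy z Bz; apply: (vdisjoint_subspace z).2; [exact: cx|exact: cy].
have dec' x : exists b, B b /\ vdisjoint_compl B (x - b).
  by have [b [c [Bb Cc ->]]] := dec x; exists b; rewrite addrC addKr.
have [f fP] := choice dec'.
have f_uniq x b : B b -> vdisjoint_compl B (x - b) -> f x = b.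
  move=> Bb Cb; have [Bf Cf] := fP x.
  apply/eqP; rewrite -subr_eq0; apply/eqP/vabs_eq0.
  have BD : B (f x - b) by rewrite -[f x]scale1r; apply: BP => //; exact: BN.
  have CD : vdisjoint_compl B (f x - b).
    have -> : f x - b = -1 *: (x - f x) + (x - b).
      by rewrite scaleN1r opprB addrA subrK.
    exact: complP.
  apply/le_anti; rewrite vabs_ge0 andbT.
  exact: (vmeet0_le0 (CD _ BD)).
(* The components are disjoint with a nonnegative sum, so the negative of each lies below both
   moduli and hence below 0. *)
have f_ge0 x : 0 <= x -> 0 <= f x /\ 0 <= x - f x.
  move=> x0; have [Bf Cf] := fP x; have dis := Cf _ Bf.
  have decx : 0 <= f x + (x - f x) by rewrite addrC subrK.
  have nn u : - u <= 0 -> 0 <= u by rewrite voppr_le add0r.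
  split; apply: nn; apply: (vmeet0_le0 dis); rewrite ?leN_vabs //.
    by apply: le_trans (le_vabs _); rewrite voppr_le addrC.
  by apply: le_trans (le_vabs _); rewrite voppr_le.
have f_lin : linear f.
  move=> a x y; have [Bx Cx] := fP x; have [By Cy] := fP y.
  apply: f_uniq; first exact: BP.
  by rewrite opprD addrACA -scalerBr; apply: complP.
have f_id x : B x -> f x = x by move=> Bx; apply: f_uniq; rewrite ?subrr.
have f_idem x : f (f x) = f x by apply: f_id; exact: (fP x).1.
have f_pos x : 0 <= x -> 0 <= f x by case/f_ge0.
have f_le x : 0 <= x -> f x <= x by move=> /f_ge0[_]; rewrite vlat_subr_ge0.
exists (OrderProj f_lin f_idem f_pos f_le).
by split=> //= x Cx; apply: f_uniq; rewrite ?subr0.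
Qed.

(** Project onto the principal band of [x]. The elements disjoint from [y] form a band containing
    [x], so they contain that whole band. *)
Lemma ppp_oproj_separates x y : principal_projection_property E ->
  vdisjoint x y -> exists p : orderProj E, p x = x /\ p y = 0.
Proof.
move=> ppp xy; have [p [pid pnil]] := projection_band_oproj (ppp x).
exists p; split; first by apply: pid => B _.
apply: pnil => z zx; apply: vdisjointC.
exact: zx (vdisjoint_band y) xy.
Qed.

(** The infimum is the supremum of the set of lower bounds. *)
Lemma dedekind_complete_glb (A : set E) (l : E) : dedekind_complete E ->
  A !=set0%classic -> (forall x, A x -> l <= x) ->
  exists g, (forall x, A x -> g <= x) /\
            (forall z, (forall x, A x -> z <= x) -> z <= g).
Proof.
move=> dc [a Aa] lA.
have [g [gub glub]] := dc [set z | forall x, A x -> z <= x]%classic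
  (ex_intro _ l lA) (ex_intro _ a (fun z (zA : forall x, A x -> z <= x) => zA a Aa)).
by exists g; split=> [x Ax|z zA]; [apply: glub => z; apply | exact: gub].
Qed.

(** * Partitions of the identity and their refinement *)

Lemma oprojI_eq0 p q : oprojI p q = oproj0 -> forall x, p (q x) = 0.
Proof. by move=> pq x; have := congr1 (fun r : orderProj E => r x) pq. Qed.

(** The common refinement of [p] with the pair [q], [oprojN q]. The size [n.+1 + n.+1] is again a
    successor, so lower bounds over nonempty families apply to it directly. *)
Definition split_partition n (p : 'I_n.+1 -> orderProj E) q
    (i : 'I_(n.+1 + n.+1)) : orderProj E :=
  match fintype.split i with
  | inl j => oprojI (p j) q
  | inr j => oprojI (p j) (oprojN q)
  end.

Lemma split_partition_lshift n (p : 'I_n.+1 -> orderProj E) q j :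
  split_partition p q (lshift n.+1 j) = oprojI (p j) q.
Proof. by rewrite /split_partition (unsplitK (inl j)). Qed.

Lemma split_partition_rshift n (p : 'I_n.+1 -> orderProj E) q j :
  split_partition p q (rshift n.+1 j) = oprojI (p j) (oprojN q).
Proof. by rewrite /split_partition (unsplitK (inr j)). Qed.

Lemma split_partition_of_id n (p : 'I_n.+1 -> orderProj E) q :
  partition_of_id p -> partition_of_id (split_partition p q).
Proof.
move=> [dis sum1]; split=> [k j|x].
  have dis' i i' : i != i' -> forall z, p i (p i' z) = 0.
    by move=> /dis; exact: oprojI_eq0.
  case: (split_ordP k) => k' ->; case: (split_ordP j) => j' ->;
    rewrite ?split_partition_lshift ?split_partition_rshift => kj;
    apply: orderProj_eq => x /=.
  - rewrite (oprojC q (p j')) dis' //; apply: contraNneq kj => -> //.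
  - by rewrite (oprojC q (p j')) oprojB oproj_idem subrr !oproj0r.
  - by rewrite (oprojC q (p j')) oproj_idem subrr oproj0r.
  - rewrite (oprojC q (p j')) -oprojB dis' //; apply: contraNneq kj => -> //.
rewrite big_split_ord /= -[RHS]sum1 -big_split; apply: eq_bigr => i _ /=.
by rewrite split_partition_lshift split_partition_rshift /= -oprojD addrC subrK.
Qed.

End VectorLatticeTheory.

(** * Orthogonally additive and atomic operators *)

Section OperatorTheory.
Context {R : realType} {E F : vectorLatticeType R}.
Implicit Types (S T G : E -> F) (x : E) (p q : orderProj E).

Lemma op_leP S T : op_le S T <-> forall x, S x <= T x.
Proof.
by split=> h x; have := h x; rewrite -(vlat_subr_ge0 (S x)).
Qed.

Lemma oa_op0 T : orthogonally_additive T -> T 0 = 0.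
Proof.
move=> /(_ 0 0 (vdisjoint_subspace 0).1); rewrite addr0 => T0.
by apply: (@addIr _ (T 0)); rewrite -T0 add0r.
Qed.

Lemma oa_opB S T : orthogonally_additive S -> orthogonally_additive T ->
  orthogonally_additive (S - T).
Proof.
move=> oaS oaT x y xy.
have subE z : (S - T) z = S z - T z by [].
by rewrite !subE oaS // oaT // opprD addrACA.
Qed.

Lemma OAr_oa T : OAr T -> orthogonally_additive T.
Proof. by move=> [T' [T'' [oa' _ oa'' _ ->]]]; exact: oa_opB. Qed.

Lemma pos_oa_OAr T : orthogonally_additive T -> positive_op T -> OAr T.
Proof.
move=> oaT posT; exists T, 0; split=> // [x y _|]; last by rewrite subr0.
by change (0 = 0 + 0 :> F); rewrite addr0.
Qed.

Lemma oa_op_oproj T p x : orthogonally_additive T ->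
  T x = T (p x) + T (x - p x).
Proof.
move=> oaT; rewrite -oaT ?[p x + _]addrC ?subrK //.
by apply: (oproj_vdisjoint (p := p)); rewrite ?oprojB ?oproj_idem ?subrr.
Qed.

(** This replaces monotonicity, which a positive nonlinear operator may lack: the discarded part
    [T (x - p x)] is nonnegative. *)
Lemma pos_oa_oproj_le T p x : orthogonally_additive T ->
  positive_op T -> T (p x) <= T x.
Proof. by move=> oaT posT; rewrite (oa_op_oproj p x oaT) vler_addl. Qed.

Lemma oa_op_sum T n (p : 'I_n -> orderProj E) x : orthogonally_additive T ->
  (forall k j, k != j -> oprojI (p k) (p j) = oproj0) ->
  T (\sum_(i < n) p i x) = \sum_(i < n) T (p i x).
Proof.
move=> oaT; elim: n p => [|n IHn] p dis; first by rewrite !big_ord0 oa_op0.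
rewrite !big_ord_recr /= oaT ?IHn // => [k j kj|]; first exact: dis.
(* The last projection fixes its own term and annihilates the sum of the others. *)
apply/vdisjointC/(oproj_vdisjoint (p := p ord_max)); first exact: oproj_idem.
rewrite linear_sum big1 // => i _; apply: oprojI_eq0; apply: dis.
by rewrite neq_ltn /= ltn_ord orbT.
Qed.

Lemma oa_op_partition T n (p : 'I_n -> orderProj E) x :
  orthogonally_additive T -> partition_of_id p -> T x = \sum_(i < n) T (p i x).
Proof. by move=> oaT [dis sum1]; rewrite -oa_op_sum ?sum1. Qed.

Section Atomic.
Context (Phi : orderProj E -> orderProj F) (homPhi : boolean_hom Phi).

Definition partition_sum T n (p : 'I_n -> orderProj E) x : F :=
  \sum_(i < n) Phi (p i) (T (p i x)).

Lemma atomicP T : atomic_ops Phi T <->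
  forall p x, T (p x) = Phi p (T x).
Proof.
split=> [h p x|h p]; last by apply/funext => x; exact: h.
by have := congr1 (fun f : E -> F => f x) (h p).
Qed.

Lemma Phi_I p q y : Phi (oprojI p q) y = Phi p (Phi q y).
Proof. by case: homPhi => _ -> _. Qed.

Lemma Phi_N p y : Phi (oprojN p) y = y - Phi p y.
Proof. by case: homPhi => _ _ ->. Qed.

(** For [p] fixing [x] and killing [y], the values [T x] and [T y] are the two complementary
    components of [T (x + y)] under [Phi p]. *)
Lemma atomic_oa T : principal_projection_property E ->
  atomic_ops Phi T -> orthogonally_additive T.
Proof.
move=> ppp /atomicP atT x y xy; have [p [px py]] := ppp_oproj_separates ppp xy.
have Tx : T x = Phi p (T (x + y)) by rewrite -atT oprojD px py addr0.
have Ty : T y = Phi (oprojN p) (T (x + y)).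
  by rewrite -atT /= oprojD px py addr0 addrC addKr.
by rewrite Tx Ty Phi_N [RHS]addrC subrK.
Qed.

Lemma atomicB S T : atomic_ops Phi S -> atomic_ops Phi T ->
  atomic_ops Phi (S - T).
Proof.
move=> /atomicP aS /atomicP aT; apply/atomicP => p x.
by change (S (p x) - T (p x) = Phi p (S x - T x)); rewrite aS aT oprojB.
Qed.

Lemma atomic_vabs T : atomic_ops Phi T -> atomic_ops Phi (fun x => vabs (T x)).
Proof. by move=> /atomicP aT; apply/atomicP => p x; rewrite aT oproj_vabs. Qed.

(** * Sums over a partition *)

Lemma partition_sum_ge0 T n (p : 'I_n -> orderProj E) x :
  positive_op T -> 0 <= partition_sum T p x.
Proof. by move=> posT; apply: vsum_ge0 => i; apply: oproj_ge0. Qed.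

Lemma partition_sum_le T n (p : 'I_n -> orderProj E) x :
  orthogonally_additive T -> positive_op T -> partition_of_id p ->
  partition_sum T p x <= T x.
Proof.
move=> oaT posT pid; rewrite (oa_op_partition x oaT pid).
by apply: vler_sum => i; apply: oproj_le_id.
Qed.

Lemma partition_sum_mono S T n (p : 'I_n -> orderProj E) x :
  (forall z, S z <= T z) -> partition_sum S p x <= partition_sum T p x.
Proof. by move=> ST; apply: vler_sum => i; apply: oproj_mono. Qed.

Lemma partition_sumD S T n (p : 'I_n -> orderProj E) x :
  partition_sum (fun z => S z + T z) p x =
  partition_sum S p x + partition_sum T p x.
Proof. by rewrite -big_split; apply: eq_bigr => i _; rewrite oprojD. Qed.

Lemma atomic_partition_sum T n (p : 'I_n -> orderProj E) x :
  orthogonally_additive T -> atomic_ops Phi T -> partition_of_id p ->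
  partition_sum T p x = T x.
Proof.
move=> oaT /atomicP aT pid; rewrite (oa_op_partition x oaT pid).
by apply: eq_bigr => i _; rewrite aT oproj_idem.
Qed.

(** The half of the refinement under [oprojN q] is killed by [Phi q] from outside. The next lemma
    reaches the same expression by putting [q] inside, where that half only sees [T 0 = 0]. *)
Lemma oproj_split_partition_sum T n (p : 'I_n.+1 -> orderProj E) q x :
  Phi q (partition_sum T (split_partition p q) x) =
  \sum_(i < n.+1) Phi (p i) (Phi q (T (p i (q x)))).
Proof.
rewrite /partition_sum big_split_ord /= oprojD !linear_sum /= [X in _ + X]big1.
  rewrite addr0; apply: eq_bigr => i _; rewrite split_partition_lshift Phi_I /=.
  by rewrite (oprojC (Phi q)) oproj_idem.
move=> i _; rewrite split_partition_rshift Phi_I Phi_N oprojC oprojB.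
by rewrite [Phi q (Phi q _)]oproj_idem subrr oproj0r.
Qed.

Lemma split_partition_sum_oproj T n (p : 'I_n.+1 -> orderProj E) q x :
  orthogonally_additive T ->
  partition_sum T (split_partition p q) (q x) =
  \sum_(i < n.+1) Phi (p i) (Phi q (T (p i (q x)))).
Proof.
move=> oaT; rewrite /partition_sum big_split_ord /= [X in _ + X]big1.
  rewrite addr0; apply: eq_bigr => i _; rewrite split_partition_lshift Phi_I /=.
  by rewrite oproj_idem.
move=> i _; rewrite split_partition_rshift /= oproj_idem subrr oproj0r.
by rewrite oa_op0 // oproj0r.
Qed.

(** * The pointwise infimum of the partition sums *)

Lemma trivial_partition :
  partition_of_id (fun _ : 'I_1 => oprojN (oproj0 : orderProj E)).
Proof.
by split=> [k j|x]; [rewrite !ord1 | rewrite big_ord1 /= subr0].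
Qed.

Lemma partition_inf_exists T : dedekind_complete F -> positive_op T ->
  exists G : E -> F,
    (forall x n (p : 'I_n.+1 -> orderProj E),
       partition_of_id p -> G x <= partition_sum T p x) /\
    (forall x z, (forall n (p : 'I_n.+1 -> orderProj E),
       partition_of_id p -> z <= partition_sum T p x) -> z <= G x).
Proof.
move=> dc posT.
pose A x : set F := [set y | exists n (p : 'I_n.+1 -> orderProj E),
  partition_of_id p /\ y = partition_sum T p x]%classic.
have infA x : exists g, (forall y, A x y -> g <= y) /\
    (forall z, (forall y, A x y -> z <= y) -> z <= g).
  apply: (@dedekind_complete_glb _ _ _ 0) => //.
    by eexists; exists 0, (fun=> oprojN oproj0); split; [exact: trivial_partition|].
  by move=> _ [n [p [_ ->]]]; exact: partition_sum_ge0.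
have [G GP] := choice infA; exists G; split=> [x n p pid|x z zA].
  by apply: (GP x).1; exists n, p.
by apply: (GP x).2 => _ [n [p [pid ->]]]; exact: zA.
Qed.

Lemma partition_inf_atomic T G : orthogonally_additive T -> positive_op T ->
  (forall x n (p : 'I_n.+1 -> orderProj E),
     partition_of_id p -> G x <= partition_sum T p x) ->
  (forall x z, (forall n (p : 'I_n.+1 -> orderProj E),
     partition_of_id p -> z <= partition_sum T p x) -> z <= G x) ->
  atomic_ops Phi G.
Proof.
move=> oaT posT Glb Gglb; apply/atomicP => q x.
have G0 z : 0 <= G z by apply: Gglb => n p _; exact: partition_sum_ge0.
apply/le_anti/andP; split; last first.
  (* For [Phi q (G x) <= G (q x)]: bound [G x] by the refined sum, apply [Phi q], then drop the
     inner [Phi q] to reach the sum of [p] at [q x]. *)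
  apply: Gglb => n p pid.
  have := oproj_mono (Phi q) (Glb x _ _ (split_partition_of_id q pid)).
  rewrite oproj_split_partition_sum => /le_trans; apply.
  by apply: vler_sum => i; apply/oproj_mono/oproj_le_id.
have G_le n (p : 'I_n.+1 -> orderProj E) : partition_of_id p ->
    G (q x) <= Phi q (partition_sum T p x).
  move=> pid; apply: le_trans (Glb _ _ _ (split_partition_of_id q pid)) _.
  rewrite split_partition_sum_oproj // linear_sum; apply: vler_sum => i /=.
  rewrite (oprojC (Phi q)); do 2 apply: oproj_mono.
  by rewrite oprojC; exact: pos_oa_oproj_le.
(* By [G_le], [G (q x)] lies below an element of the range of [Phi q], so its complementary
   component is at most 0. *)
have G_fix : Phi q (G (q x)) = G (q x).
  apply/le_anti; rewrite oproj_le_id //=.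
  have := oproj_mono (oprojN (Phi q)) (G_le _ _ trivial_partition).
  by rewrite /= oproj_idem subrr vle_subl_addr add0r.
(* Writing [G (q x)] as its own image under [Phi q] reduces the goal to [G (q x) <= G x], where the
   infimum property applies without commuting it with [Phi q]. *)
rewrite -G_fix; apply/oproj_mono/Gglb => n p pid.
apply: le_trans (G_le _ _ pid) _; apply/oproj_le_id; exact: partition_sum_ge0.
Qed.

End Atomic.
End OperatorTheory.

(** * Identification of [T1] with the infimum *)

Theorem theorem2p8 (R : realType) (E F : vectorLatticeType R)
    (archE : archimedean_vlat E) (archF : archimedean_vlat F)
    (pppE : principal_projection_property E)
    (dcF : dedekind_complete F)
    (Phi : orderProj E -> orderProj F) (homPhi : boolean_hom Phi)
    (T : E -> F) (oaT : orthogonally_additive T) (posT : positive_op T)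
    (T1 T2 : E -> F) (T1_atomic : atomic_ops Phi T1)
    (T2_disjoint : disjoint_compl_OAr (atomic_ops Phi) T2)
    (decT : T = T1 + T2) :
  is_inf_OAr (partition_sums Phi T) T1.
Proof.
have [G [Glb Gglb]] := partition_inf_exists Phi dcF posT.
have atG := partition_inf_atomic homPhi oaT posT Glb Gglb.
have oaG := atomic_oa homPhi pppE atG.
have posG : positive_op G.
  by move=> x; apply: Gglb => n p _; exact: partition_sum_ge0.
suff T1G : T1 = G.
  rewrite T1G; split; first exact: pos_oa_OAr.
    by move=> S [n [p [pid ->]]]; apply/op_leP => x; exact: Glb.
  move=> U _ Ulb; apply/op_leP => x; apply: Gglb => n p pid.
  have /op_leP US : op_le U (partition_sum Phi T p) by apply: Ulb; exists n, p.
  exact: US.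
pose K : E -> F := G - T1; pose absK x := vabs (K x).
have atK : atomic_ops Phi K by exact: atomicB.
have ataK : atomic_ops Phi absK by exact: atomic_vabs.
have oaaK := atomic_oa homPhi pppE ataK.
have OAraK : OAr absK by apply: pos_oa_OAr => // x; exact: vabs_ge0.
(* [B] and [A] are the moduli of [T2] and [K] in [OAr]. *)
have [_ /(_ K atK)[B [A [[OArB Bub _] [_ Aub _] [_ _ inf0]]]]] := T2_disjoint.
have /op_leP B1 : op_le T2 B by apply: Bub; left.
have /op_leP B2 : op_le (- T2) B by apply: Bub; right.
have /op_leP A1 : op_le K A by apply: Aub; left.
have /op_leP A2 : op_le (- K) A by apply: Aub; right.
have oaB := OAr_oa OArB.
have posB : positive_op B.
  by move=> x; apply: le_trans (vabs_ge0 (T2 x)) _; apply: vabs_le; [exact: B1|exact: B2].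
pose H : E -> F := T - G.
have posH x : 0 <= H x.
  rewrite /H -[_ x]/(T x - G x) vlat_subr_ge0.
  apply: le_trans (Glb x _ _ trivial_partition) _.
  exact: partition_sum_le trivial_partition.
have T2E x : T2 x = H x + K x.
  rewrite /H /K decT.
  change (T2 x = (T1 x + T2 x - G x) + (G x - T1 x)).
  by rewrite addrA subrK addrC addKr.
(* Here [K <= T2 <= B] because [H >= 0], while [- K = - T2 + H <= B + H]. *)
have absK_le x : absK x <= B x + H x.
  apply: vabs_le.
    apply: (@le_trans _ _ (B x)); last exact: vler_addl.
    by apply: le_trans (B1 x); rewrite T2E addrC vler_addl.
  rewrite -vle_subl_addr; apply: le_trans (B2 x).
  by change (- K x - H x <= - T2 x); rewrite T2E [- (H x + _)]opprD [leLHS]addrC.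
have absK_B x : absK x <= B x.
  (* Adding [G x] to both sides puts the bound in the form of a lower bound for the partition sums
     of [T]. *)
  suff : absK x - B x + G x <= G x.
    by rewrite -[X in _ <= X]add0r -vle_subl_addr addrK vle_subl_addr add0r.
  apply: Gglb => n p pid.
  have sumT : partition_sum Phi T p x = partition_sum Phi H p x + G x.
    have -> : T = (fun z => H z + G z).
      by apply/funext => z; rewrite -[H z]/(T z - G z) subrK.
    by rewrite partition_sumD (atomic_partition_sum x oaG atG pid).
  rewrite sumT vleD // vle_subl_addr -(atomic_partition_sum x oaaK ataK pid).
  apply: le_trans (partition_sum_mono Phi p x absK_le) _.
  by rewrite partition_sumD addrC vleD // partition_sum_le.
(* [absK] belongs to [OAr] and lies below both moduli, whose infimum there is 0. *)
have /op_leP K0 : op_le absK 0.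
  apply: inf0 => // S [->|->]; apply/op_leP => // x.
  by apply: vabs_le; [exact: A1|exact: A2].
apply/funext => x; apply/esym/eqP; rewrite -subr_eq0; apply/eqP/vabs_eq0/le_anti.
by rewrite vabs_ge0 andbT; exact: K0.
Qed.
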